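(* Let $(\tilde z,p)$ be a solution on $[0,T)$ of the reduced order model $$M_{\tilde z}(p(t))\dot{\tilde z}(t)+N(p(t))D(\tilde z(t))\dot p(t)=\tilde F_{\tilde z}(p(t),\tilde z(t)),$$ $$D(\tilde z(t))^TN(p(t))^T\dot{\tilde z}(t)+D(\tilde z(t))^TM_p(p(t))D(\tilde z(t))\dot p(t)=D(\tilde z(t))^T\tilde F_p(p(t),\tilde z(t)).$$ For $t\in(0,T)$, $x\in\mathbb R^r$ and $\eta=(\eta_1,\dots,\eta_r)\in\mathcal P=\mathcal P_1\times\dots\times\mathcal P_r$ define $$\mathscr R(t,x,\eta)=\sum_{i=1}^rx_i\mathcal T_i(p_i(t))\varphi_i+\sum_{i=1}^r\tilde z_i(t)\,[\mathcal T_i'(p_i(t))\varphi_i]\eta_i-\mathcal F\Big(\sum_{i=1}^r\tilde z_i(t)\mathcal T_i(p_i(t))\varphi_i\Big)\in\mathscr X.$$ Then the reduced order model is continuously optimal: for each $t\in(0,T)$, $$\|\mathscr R(t,\dot{\tilde z}(t),\dot p(t))\|_{\mathscr X}\le\|\mathscr R(t,x,\eta)\|_{\mathscr X}\qquad\text{for all }(x,\eta)\in\mathbb R^r\times\mathcal P.$$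
   Context: $(\mathscr X,\langle\cdot,\cdot\rangle_{\mathscr X})$ is a separable real Hilbert space, $\mathscr Y\subseteq\mathscr X$ a dense subspace, $\mathcal F\colon\mathscr Y\to\mathscr X$ a (possibly nonlinear) operator. $r\in\mathbb N$, modes $\varphi_1,\dots,\varphi_r\in\mathscr Y$ are given. $\mathcal P_i=\mathbb R^{q_i}$, $q=\sum_{i=1}^rq_i$, $\mathcal P=\mathcal P_1\times\dots\times\mathcal P_r=\mathbb R^q$. The transformation operators $\mathcal T_i\colon\mathcal P_i\to\mathcal B(\mathscr X)$ (bounded linear operators on $\mathscr X$) satisfy $\mathcal T_i(\eta)\mathscr Y\subseteq\mathscr Y$, and the maps $\mathcal T_i(\cdot)\varphi_i\colon\mathcal P_i\to\mathscr Y$ are continuously differentiable; the derivative at $p_i$ is denoted $[\mathcal T_i'(p_i)\varphi_i]$ and regarded as a linear map $\mathcal P_i\to\mathscr X$. $e_k$ denotes the $k$th unit vector of $\mathbb R^{q_i}$ of suitable dimension. For $p=(p_1,\dots,p_r)\in\mathcal P$ and $\tilde z\in\mathbb R^r$ define, with indices of $\mathbb R^q$ written as pairs $(i,k)$, $1\le i\le r$, $1\le k\le q_i$: - $M_{\tilde z}(p)\in\mathbb R^{r\times r}$ with entries $\langle\mathcal T_i(p_i)\varphi_i,\mathcal T_j(p_j)\varphi_j\rangle_{\mathscr X}$; - $N(p)\in\mathbb R^{r\times q}$ with entry at row $i$, column $(j,k)$ equal to $\langle\mathcal T_i(p_i)\varphi_i,[\mathcal T_j'(p_j)\varphi_j]e_k\rangle_{\mathscr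 X}$; - $M_p(p)\in\mathbb R^{q\times q}$ with entry at row $(i,k)$, column $(j,l)$ equal to $\langle[\mathcal T_i'(p_i)\varphi_i]e_k,[\mathcal T_j'(p_j)\varphi_j]e_l\rangle_{\mathscr X}$; - $D(\tilde z)=\mathrm{diag}(\tilde z_1I_{q_1},\dots,\tilde z_rI_{q_r})\in\mathbb R^{q\times q}$; - $\tilde F_{\tilde z}(p,\tilde z)\in\mathbb R^r$ with $i$th entry $\langle\mathcal T_i(p_i)\varphi_i,\mathcal F(\sum_{j=1}^r\tilde z_j\mathcal T_j(p_j)\varphi_j)\rangle_{\mathscr X}$; - $\tilde F_p(p,\tilde z)\in\mathbb R^q$ with $(i,k)$th entry $\langle[\mathcal T_i'(p_i)\varphi_i]e_k,\mathcal F(\sum_{j=1}^r\tilde z_j\mathcal T_j(p_j)\varphi_j)\rangle_{\mathscr X}$. A solution on $[0,T)$ is a pair of functions $\tilde z\colon[0,T)\to\mathbb R^r$, $p\colon[0,T)\to\mathcal P$, continuous on $[0,T)$ and differentiable on $(0,T)$, satisfying both equations for all $t\in(0,T)$. *)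

(* Defs.v *)
From HB Require Import structures.
From mathcomp Require Import all_boot all_order all_algebra.
From mathcomp Require Import all_classical all_reals all_analysis.

Set Implicit Arguments.
Unset Strict Implicit.
Unset Printing Implicit Defensive.

Import Order.TTheory GRing.Theory Num.Theory.
Import numFieldNormedType.Exports.

Local Open Scope classical_set_scope.
Local Open Scope ring_scope.

(* A Hilbert space is a complete normed space whose norm comes from an inner
   product; over a real scalar field the involution is the identity. *)
Definition induces_norm (R : realType) (X : normedModType R)
    (dot : {dot X for idfun}) : Prop :=
  forall x : X, `|x| ^+ 2 = dot x x.

Definition separable (X : topologicalType) : Prop :=
  exists2 S : set X, countable S & dense S.

Definition bounded_operator (R : realType) (X : normedModType R)
    (A : {linear X -> X}) : Prop :=
  exists C : R, forall x : X, `|A x| <= C * `|x|.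

(* [f] is continuously differentiable as a map into the subspace [Y] of [X],
   normed by the norm of [X]: the values and the derivatives of [f] lie in [Y],
   and the derivative depends continuously on the point in operator norm (the
   bound in the last clause says that the operator norm of the difference of
   the two derivatives is at most [e]). *)
Definition continuously_differentiable_into (R : realType)
    (P X : normedModType R) (Y : set X) (f : P -> X) : Prop :=
  [/\ forall u, Y (f u),
      forall u, differentiable f u,
      forall u h, Y ('d f u h)
    & forall u (e : R), 0 < e ->
        \forall v \near u, forall h, `|'d f v h - 'd f u h| <= e * `|h| ].

(* The parameter space R^q, q = q_1 + ... + q_r, is the space of column vectors
   ['cV[R]_(\sum_i q i)]; a pair index (i, k) is row k of block i, and
   [submxcol p i] is the component p_i.  [F] is a total function, but it is only
   ever evaluated at points of the subspace on which it is given. *)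
Section ReducedOrderModel.
Context (R : realType) (X : completeNormedModType R) (dot : {dot X for idfun}).
Context (F : X -> X).
Context (r : nat) (q : 'I_r -> nat).
Context (T : forall i : 'I_r, 'cV[R]_(q i) -> {linear X -> X}).
Context (phi : 'I_r -> X).

Implicit Types (i j : 'I_r) (p eta : 'cV[R]_(\sum_i q i)) (z x : 'cV[R]_r).

Definition mode p i : X := T (submxcol p i) (phi i).

Definition dmode p i : {linear 'cV[R]_(q i) -> X} :=
  'd (fun u : 'cV[R]_(q i) => T u (phi i)) (submxcol p i).

Definition unit_vector n (k : 'I_n) : 'cV[R]_n := delta_mx k 0.

Definition ansatz p z : X := \sum_j z j 0 *: mode p j.

Definition M_z p : 'M[R]_r := \matrix_(i, j) dot (mode p i) (mode p j).

Definition N p : 'M[R]_(r, \sum_i q i) :=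
  \mxrow_(j < r) (\matrix_(i < r, k < q j)
    dot (mode p i) (dmode p j (unit_vector k))).

Definition M_p p : 'M[R]_(\sum_i q i) :=
  \mxblock_(i < r, j < r) (\matrix_(k < q i, l < q j)
    dot (dmode p i (unit_vector k)) (dmode p j (unit_vector l))).

Definition D z : 'M[R]_(\sum_i q i) := \mxdiag_(i < r) ((z i 0)%:M : 'M[R]_(q i)).

Definition F_z p z : 'cV[R]_r := \col_i dot (mode p i) (F (ansatz p z)).

Definition F_p p z : 'cV[R]_(\sum_i q i) :=
  \mxcol_(i < r) (\col_(k < q i)
    dot (dmode p i (unit_vector k)) (F (ansatz p z))).

(* Solution on [0, Tend); [Tend = +oo] is allowed, and the values of [z] and [p]
   outside of the interval are irrelevant. *)
Definition rom_solution (Tend : \bar R)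
    (z : R -> 'cV[R]_r) (p : R -> 'cV[R]_(\sum_i q i)) : Prop :=
  [/\ {within [set t : R | 0 <= t /\ (t%:E < Tend)%E], continuous z},
      {within [set t : R | 0 <= t /\ (t%:E < Tend)%E], continuous p}
    & forall t : R, 0 < t -> (t%:E < Tend)%E ->
      [/\ derivable z t 1,
          derivable p t 1,
          M_z (p t) *m derive1 z t + N (p t) *m D (z t) *m derive1 p t
            = F_z (p t) (z t)
        & (D (z t))^T *m (N (p t))^T *m derive1 z t
            + (D (z t))^T *m M_p (p t) *m D (z t) *m derive1 p t
            = (D (z t))^T *m F_p (p t) (z t)] ].

Definition residual (z : R -> 'cV[R]_r) (p : R -> 'cV[R]_(\sum_i q i))
    (t : R) x eta : X :=
  \sum_i x i 0 *: mode (p t) i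
  + \sum_i z t i 0 *: dmode (p t) i (submxcol eta i)
  - F (ansatz (p t) (z t)).

End ReducedOrderModel.

(* Main.v *)
(** The reduced order model is the system of normal equations of the least
    squares problem for the residual: it says that the residual of
    [(z', p')] is orthogonal to all modes and, up to the factors [z_i], to all
    parameter derivatives of the modes. Every other residual differs from it by
    an element of the span of these vectors, so that Pythagoras applies. The
    second equation gives no information on the block [i] when [z_i = 0], but
    then this block does not contribute to the span either. *)
Require Import Defs.
From HB Require Import structures.
From mathcomp Require Import all_boot all_order all_algebra.
From mathcomp Require Import all_classical all_reals all_analysis.

Set Implicit Arguments.
Unset Strict Implicit.
Unset Printing Implicit Defensive.

Import Order.TTheory GRing.Theory Num.Theory.
Import numFieldNormedType.Exports.

Local Open Scope classical_set_scope.
Local Open Scope ring_scope.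

Section RealDot.
Context (R : realType) (X : normedModType R) (dot : {dot X for idfun}).
Implicit Types a b : X.

Lemma dotC a b : dot a b = dot b a.
Proof. by rewrite hermC expr0 mul1r. Qed.

Lemma dot_sumZr (I : finType) a (c : I -> R) (f : I -> X) :
  dot a (\sum_i c i *: f i) = \sum_i c i * dot a (f i).
Proof. by rewrite linear_sumr; apply: eq_bigr => i _; rewrite linearZr_LR. Qed.

(** Pythagoras: for orthogonal [a] and [b] the squared norm of [b + a] exceeds that of [b] by the
    squared norm of [a]. *)
Lemma le_norm_orthogonal (hdot : induces_norm dot) a b :
  dot a b = 0 -> `|b| <= `|b + a|.
Proof.
move=> ab0; rewrite -(@ler_pXn2r _ 2) ?nnegrE ?normr_ge0 // !hdot.
rewrite linearDr !linearDl /= (dotC b a) ab0 addr0 add0r.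
by rewrite lerDl -hdot exprn_ge0.
Qed.

End RealDot.

Section Velocity.
Context (R : realType) (X : completeNormedModType R) (dot : {dot X for idfun}).
Context (F : X -> X) (r : nat) (q : 'I_r -> nat).
Context (T : forall i : 'I_r, 'cV[R]_(q i) -> {linear X -> X}).
Context (phi : 'I_r -> X).
Implicit Types (p eta : 'cV[R]_(\sum_i q i)) (z x : 'cV[R]_r).

(** Formal time derivative of [ansatz], by the product and chain rules, when [z] and [p] move with
    speeds [x] and [eta]. It is linear in [(x, eta)], so two residuals at the same time differ by a
    velocity. *)
Definition velocity p z x eta : X :=
  \sum_i x i 0 *: mode T phi p i
  + \sum_i z i 0 *: dmode T phi p i (submxcol eta i).

Lemma velocityB p z x1 x2 eta1 eta2 :
  velocity p z x1 eta1 - velocity p z x2 eta2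
  = velocity p z (x1 - x2) (eta1 - eta2).
Proof.
rewrite /velocity opprD addrACA -!sumrB; congr (_ + _); apply: eq_bigr => i _.
  by rewrite -scalerBl !mxE.
by rewrite -scalerBr -linearB submxcolB.
Qed.

Lemma dmode_unit_vector p i (h : 'cV[R]_(q i)) :
  dmode T phi p i h = \sum_k h k 0 *: dmode T phi p i (unit_vector R k).
Proof.
rewrite {1}[h]matrix_sum_delta linear_sum; apply: eq_bigr => k _.
by rewrite big_ord1 linearZ.
Qed.

Lemma mulmx_D z eta : D q z *m eta = \mxcol_i (z i 0 *: submxcol eta i).
Proof.
rewrite -{1}(submxcolK eta) mul_mxdiag_mxcol.
by apply: eq_mxcol => i; rewrite mul_scalar_mx.
Qed.

Lemma dot_velocity a p z x eta :
  dot a (velocity p z x eta)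
  = \sum_i x i 0 * dot a (mode T phi p i)
    + \sum_i \sum_k z i 0 * submxcol eta i k 0
        * dot a (dmode T phi p i (unit_vector R k)).
Proof.
rewrite /velocity linearDr /= !dot_sumZr; congr (_ + _); apply: eq_bigr => i _.
rewrite dmode_unit_vector dot_sumZr mulr_sumr.
by apply: eq_bigr => k _; rewrite mulrA.
Qed.

(** Bilinearity, with each derivative term expanded over the unit vectors, turns the Gram matrices
    into pairings with one velocity. *)
Lemma mode_equationE p z x eta :
  M_z dot T phi p *m x + N dot T phi p *m D q z *m eta
  = \col_i dot (mode T phi p i) (velocity p z x eta).
Proof.
apply/colP => i; rewrite -mulmxA mulmx_D mul_mxrow_mxcol.
rewrite !mxE summxE dot_velocity; congr (_ + _); apply: eq_bigr => j _.
  by rewrite mxE mulrC.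
by rewrite mxE; apply: eq_bigr => k _; rewrite !mxE mulrC.
Qed.

(** Stated without the left factor [(D z)^T] of the model, which may be singular and cannot be
    cancelled later. *)
Lemma dmode_equationE p z x eta :
  (N dot T phi p)^T *m x + M_p dot T phi p *m D q z *m eta
  = \mxcol_i \col_k dot (dmode T phi p i (unit_vector R k))
                        (velocity p z x eta).
Proof.
rewrite -mulmxA mulmx_D /N tr_mxrow mxcol_mul /M_p mxblockEv mxcol_mul -mxcolD.
apply: eq_mxcol => i; rewrite mul_mxrow_mxcol.
apply/colP => k; rewrite !mxE summxE dot_velocity.
congr (_ + _); apply: eq_bigr => j _.
  by rewrite !mxE mulrC dotC.
by rewrite mxE; apply: eq_bigr => l _; rewrite !mxE mulrC.
Qed.

Lemma residualE (z : R -> 'cV[R]_r) (p : R -> 'cV[R]_(\sum_i q i)) t x eta :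
  residual F T phi z p t x eta
  = velocity (p t) (z t) x eta - F (ansatz T phi (p t) (z t)).
Proof. by []. Qed.

Lemma normal_equations_orthogonal p z x eta :
    M_z dot T phi p *m x + N dot T phi p *m D q z *m eta = F_z dot F T phi p z ->
    (D q z)^T *m (N dot T phi p)^T *m x
      + (D q z)^T *m M_p dot T phi p *m D q z *m eta
      = (D q z)^T *m F_p dot F T phi p z ->
  forall x' eta',
    dot (velocity p z x' eta') (velocity p z x eta - F (ansatz T phi p z)) = 0.
Proof.
rewrite mode_equationE => /colP eqz.
(* Factor [(D z)^T] out of the left-hand side, leaving the form of [dmode_equationE]. *)
rewrite -!mulmxA -mulmxDr [M_p _ _ _ _ *m _]mulmxA dmode_equationE.
rewrite /D tr_mxdiag !mul_mxdiag_mxcol => /eq_mxcolP eqp x' eta'.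
rewrite dotC dot_velocity big1 ?add0r => [|i _].
  rewrite big1 // => i _; rewrite big1 // => k _.
  have /colP/(_ k) := eqp i; rewrite tr_scalar_mx !mul_scalar_mx !mxE => eqik.
  by rewrite mulrAC dotC linearBr /= mulrBr eqik subrr mul0r.
have := eqz i; rewrite !mxE => eqi.
by rewrite dotC linearBr /= eqi subrr mulr0.
Qed.

End Velocity.

Theorem theorem5p5 (R : realType) (X : completeNormedModType R)
    (dot : {dot X for idfun}) (hdot : induces_norm dot) (hsep : separable X)
    (Y : set X) (hY : GRing.submod_closed [in Y]) (hYdense : dense Y)
    (F : X -> X)
    (r : nat) (phi : 'I_r -> X) (hphi : forall i, Y (phi i))
    (q : 'I_r -> nat)
    (T : forall i : 'I_r, 'cV[R]_(q i) -> {linear X -> X})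
    (hTbounded : forall i (u : 'cV[R]_(q i)), bounded_operator (T i u))
    (hTY : forall i (u : 'cV[R]_(q i)) (y : X), Y y -> Y (T i u y))
    (hTC1 : forall i, continuously_differentiable_into Y
              (fun u : 'cV[R]_(q i) => T i u (phi i)))
    (Tend : \bar R)
    (z : R -> 'cV[R]_r) (p : R -> 'cV[R]_(\sum_i q i))
    (hsol : rom_solution dot F T phi Tend z p) :
  forall t : R, 0 < t -> (t%:E < Tend)%E ->
  forall (x : 'cV[R]_r) (eta : 'cV[R]_(\sum_i q i)),
    `|residual F T phi z p t (derive1 z t) (derive1 p t)|
    <= `|residual F T phi z p t x eta|.
Proof.
move=> t t0 tT x eta; have [_ _ /(_ t t0 tT)[_ _ eqz eqp]] := hsol.
rewrite !residualE.
set v := velocity _ _ _ _ (derive1 z t) _; set V := velocity _ _ _ _ x _.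
(* [Fv] depends on neither [x] nor [eta], hence cancels in the difference of the residuals. *)
set Fv := F _; have -> : V - Fv = v - Fv + (V - v) by rewrite [RHS]addrC addrA subrK.
apply: (le_norm_orthogonal hdot); rewrite velocityB.
exact: normal_equations_orthogonal.
Qed.
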